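(* Let $p\in\mathbb H$, $0<R_1<R_2$, and let $f$ be a left slice hyperholomorphic function on an axially symmetric open set containing the Cassini shell $U(p,R_1,R_2)$, where it admits the spherical Laurent expansion $$f(q)=\sum_{n\in\mathbb Z}Q_p^n(q)a_{2n}+\sum_{n\in\mathbb Z}Q_p^n(q)(q-p)a_{2n+1},\qquad a_n\in\mathbb H,$$ convergent absolutely and uniformly on compact subsets of $U(p,R_1,R_2)$. Let $g=Df$. Then $$g(q)=-4\sum_{n\in\mathbb Z}\mathcal L_n(q,p)(q_0-p_0)[a_{2n}+(\bar q-p)a_{2n+1}]-2\sum_{n\in\mathbb Z}Q_p^n(q)a_{2n+1},$$ or, alternatively, $$g(q)=-4\sum_{n\in\mathbb Z}\mathcal L_n(q,p)(q_0-p_0)[a_{2n}+(q-p)a_{2n+1}]-2\sum_{n\in\mathbb Z}Q_p^n(\bar q)a_{2n+1}.$$ Both expansions converge absolutely and uniformly on compact subsets of $U(p,R_1,R_2)$.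
   Context: $\mathbb H$ denotes the quaternions $q=q_0+q_1e_1+q_2e_2+q_3e_3$ with the usual relations ($e_i^2=-1$, $e_1e_2=-e_2e_1=e_3$, $e_2e_3=-e_3e_2=e_1$, $e_3e_1=-e_1e_3=e_2$), $\underline q=q_1e_1+q_2e_2+q_3e_3$, $\bar q=q_0-\underline q$, $\mathbb S=\{\underline q:|\underline q|=1\}$, $[q]=\{q_0+I|\underline q|:I\in\mathbb S\}$; a set $U$ is axially symmetric if $[q]\subset U$ for all $q\in U$. Slice hyperholomorphic: for $U$ axially symmetric open and $\mathcal U=\{(u,v)\in\mathbb R^2:u+\mathbb Sv\subset U\}$, $f:U\to\mathbb H$ is left slice hyperholomorphic if $f(u+Iv)=\alpha(u,v)+I\beta(u,v)$ for all $(u,v)\in\mathcal U$, $I\in\mathbb S$, with $C^1$ functions $\alpha,\beta:\mathcal U\to\mathbb H$, $\alpha$ even and $\beta$ odd in $v$, satisfying $\partial_u\alpha=\partial_v\beta$, $\partial_v\alpha=-\partial_u\beta$. $D=\partial_{q_0}+e_1\partial_{q_1}+e_2\partial_{q_2}+e_3\partial_{q_3}$ acting from the left, in $q$. $p_0=\mathrm{Re}(p)$; $Q_p(q)=q^2-2p_0q+|p|^2$, $Q_p^n(q)=(Q_p(q))^n$ for $n\in\mathbb Z$ (for $n<0$, $q\notin[p]$). The Cassini shell is $U(p,R_1,R_2)=\{q\in\mathbb H:R_1^2<|Q_p(q)|<R_2^2\}$. For $q\in\mathbb H\setminus[p]$, $$\mathcal L_n(q,p)=\begin{cases}\sum_{k=0}^{n-1}\overline{Q_p^{\,n-1-k}(q)}\,Q_p^k(q),&n\ge1,\\0,&n=0,\\-\sum_{k=0}^{|n|-1}\overline{Q_p^{-k-1}(q)}\,Q_p^{k+n}(q),&n\le-1.\end{cases}$$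 *)

(* Defs.v *)
From HB Require Import structures.
From mathcomp Require Import all_boot all_order all_algebra.
From mathcomp Require Import all_classical all_reals all_analysis.
From mathcomp Require Import ring.

Set Implicit Arguments.
Unset Strict Implicit.
Unset Printing Implicit Defensive.

Import Order.TTheory GRing.Theory Num.Theory.
Import numFieldNormedType.Exports.

Local Open Scope classical_set_scope.
Local Open Scope ring_scope.

Record quat (R : realType) := Quat { q0 : R; q1 : R; q2 : R; q3 : R }.

Section QuatRing.
Variable R : realType.
Implicit Types x y z : quat R.

Definition quat_tuple x : R * R * R * R := (q0 x, q1 x, q2 x, q3 x).
Definition tuple_quat (t : R * R * R * R) : quat R :=
  Quat t.1.1.1 t.1.1.2 t.1.2 t.2.
Lemma quat_tupleK : cancel quat_tuple tuple_quat. Proof. by case. Qed.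

HB.instance Definition _ := Choice.copy (quat R) (can_type quat_tupleK).

Definition quat_add x y :=
  Quat (q0 x + q0 y) (q1 x + q1 y) (q2 x + q2 y) (q3 x + q3 y).
Definition quat_opp x := Quat (- q0 x) (- q1 x) (- q2 x) (- q3 x).
Definition quat_mul x y := Quat
  (q0 x * q0 y - q1 x * q1 y - q2 x * q2 y - q3 x * q3 y)
  (q0 x * q1 y + q1 x * q0 y + q2 x * q3 y - q3 x * q2 y)
  (q0 x * q2 y - q1 x * q3 y + q2 x * q0 y + q3 x * q1 y)
  (q0 x * q3 y + q1 x * q2 y - q2 x * q1 y + q3 x * q0 y).
Definition quat_scale (k : R) x := Quat (k * q0 x) (k * q1 x) (k * q2 x) (k * q3 x).

Fact quat_addA : associative quat_add.
Proof. by case=> ????[????][????]; congr Quat => /=; ring. Qed.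
Fact quat_addC : commutative quat_add.
Proof. by case=> ????[????]; congr Quat => /=; ring. Qed.
Fact quat_add0 : left_id (Quat 0 0 0 0) quat_add.
Proof. by case=> ????; congr Quat => /=; ring. Qed.
Fact quat_addN : left_inverse (Quat 0 0 0 0) quat_opp quat_add.
Proof. by case=> ????; congr Quat => /=; ring. Qed.
HB.instance Definition _ := GRing.isZmodule.Build (quat R)
  quat_addA quat_addC quat_add0 quat_addN.

Fact quat_scaleA a b x : quat_scale a (quat_scale b x) = quat_scale (a * b) x.
Proof. by case: x => ????; congr Quat => /=; ring. Qed.
Fact quat_scale1 : left_id 1 quat_scale.
Proof. by case=> ????; congr Quat => /=; ring. Qed.
Fact quat_scaleDr : right_distributive quat_scale +%R.
Proof. by move=> k [????][????]; congr Quat => /=; ring. Qed.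
Fact quat_scaleDl x : {morph quat_scale^~ x : a b / a + b}.
Proof. by case: x => ???? a b; congr Quat => /=; ring. Qed.
HB.instance Definition _ := GRing.Zmodule_isLmodule.Build R (quat R)
  quat_scaleA quat_scale1 quat_scaleDr quat_scaleDl.

Fact quat_mulA : associative quat_mul.
Proof. by case=> ????[????][????]; congr Quat => /=; ring. Qed.
Fact quat_mul1l : left_id (Quat 1 0 0 0) quat_mul.
Proof. by case=> ????; congr Quat => /=; ring. Qed.
Fact quat_mul1r : right_id (Quat 1 0 0 0) quat_mul.
Proof. by case=> ????; congr Quat => /=; ring. Qed.
Fact quat_mulDl : left_distributive quat_mul +%R.
Proof. by case=> ????[????][????]; congr Quat => /=; ring. Qed.
Fact quat_mulDr : right_distributive quat_mul +%R.
Proof. by case=> ????[????][????]; congr Quat => /=; ring. Qed.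
Fact quat_oner_neq0 : Quat 1 0 0 0 != 0 :> quat R.
Proof. by apply/eqP => -[/eqP]; rewrite oner_eq0. Qed.
HB.instance Definition _ := GRing.Zmodule_isNzRing.Build (quat R)
  quat_mulA quat_mul1l quat_mul1r quat_mulDl quat_mulDr quat_oner_neq0.

Fact quat_scalerAl (k : R) x y : k *: (x * y) = (k *: x) * y.
Proof. by case: x y => ????[????]; congr Quat => /=; ring. Qed.
HB.instance Definition _ :=
  GRing.Lmodule_isLalgebra.Build R (quat R) quat_scalerAl.
Fact quat_scalerAr (k : R) x y : k *: (x * y) = x * (k *: y).
Proof. by case: x y => ????[????]; congr Quat => /=; ring. Qed.
HB.instance Definition _ :=
  GRing.Lalgebra_isAlgebra.Build R (quat R) quat_scalerAr.

Definition quat_conj x := Quat (q0 x) (- q1 x) (- q2 x) (- q3 x).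
Definition quat_sqnorm x := q0 x ^+ 2 + q1 x ^+ 2 + q2 x ^+ 2 + q3 x ^+ 2.
Definition quat_inv x := (quat_sqnorm x)^-1 *: quat_conj x.

Lemma quat_sqnorm_ge0 x : 0 <= quat_sqnorm x.
Proof. by rewrite /quat_sqnorm !addr_ge0 ?sqr_ge0. Qed.

Lemma quat_sqnorm_eq0 x : quat_sqnorm x = 0 -> x = 0.
Proof.
case: x => a b c d; rewrite /quat_sqnorm /= => /eqP.
rewrite !paddr_eq0 ?addr_ge0 ?sqr_ge0// !sqrf_eq0.
by move=> /andP[/andP[/andP[/eqP-> /eqP->] /eqP->] /eqP->].
Qed.

Fact quat_mulV : {in [pred x | x != 0], left_inverse 1 quat_inv *%R}.
Proof.
move=> x; rewrite inE => x0.
have n0 : quat_sqnorm x != 0 by apply: contra_neq x0; exact: quat_sqnorm_eq0.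
rewrite /quat_inv -scalerAl.
suff -> : quat_conj x * x = quat_sqnorm x *: 1 by rewrite scalerA mulVf// scale1r.
by case: (x) => ????; rewrite /quat_sqnorm; congr Quat => /=; ring.
Qed.
Fact quat_divr : {in [pred x | x != 0], right_inverse 1 quat_inv *%R}.
Proof.
move=> x; rewrite inE => x0.
have n0 : quat_sqnorm x != 0 by apply: contra_neq x0; exact: quat_sqnorm_eq0.
rewrite /quat_inv -scalerAr.
suff -> : x * quat_conj x = quat_sqnorm x *: 1 by rewrite scalerA mulVf// scale1r.
by case: (x) => ????; rewrite /quat_sqnorm; congr Quat => /=; ring.
Qed.
Fact quat_unitP x y : y * x = 1 /\ x * y = 1 -> [pred x | x != 0] x.
Proof.
by move=> [yx _] /=; apply/eqP => x0; move: yx; rewrite x0 mulr0 => /eqP;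
  rewrite eq_sym oner_eq0.
Qed.
Fact quat_inv_out : {in [predC [pred x | x != 0]], quat_inv =1 id}.
Proof.
move=> x; rewrite !inE negbK => /eqP ->.
by congr Quat => /=; rewrite ?oppr0 mulr0.
Qed.
HB.instance Definition _ := GRing.NzRing_hasMulInverse.Build (quat R)
  quat_mulV quat_divr quat_unitP quat_inv_out.

Definition quat_norm x := Num.sqrt (quat_sqnorm x).

Fact quat_normD x y : quat_norm (x + y) <= quat_norm x + quat_norm y.
Proof.
have sq0 z : 0 <= quat_norm z by exact: sqrtr_ge0.
rewrite -(@ler_pXn2r _ 2) ?nnegrE ?addr_ge0// sqrrD.
rewrite !sqr_sqrtr ?quat_sqnorm_ge0//.
set ip := q0 x * q0 y + q1 x * q1 y + q2 x * q2 y + q3 x * q3 y.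
have -> : quat_sqnorm (x + y) = quat_sqnorm x + ip *+ 2 + quat_sqnorm y.
  by rewrite /quat_sqnorm /ip /=; ring.
rewrite lerD2r lerD2l lerMn2r /= -sqrtrM ?quat_sqnorm_ge0//.
apply: (le_trans (ler_norm _)); rewrite -sqrtr_sqr ler_sqrt; last first.
  by rewrite mulr_ge0 ?quat_sqnorm_ge0.
rewrite -subr_ge0.
have -> : quat_sqnorm x * quat_sqnorm y - ip ^+ 2 =
    (q0 x * q1 y - q1 x * q0 y) ^+ 2 + (q0 x * q2 y - q2 x * q0 y) ^+ 2 +
    (q0 x * q3 y - q3 x * q0 y) ^+ 2 + (q1 x * q2 y - q2 x * q1 y) ^+ 2 +
    (q1 x * q3 y - q3 x * q1 y) ^+ 2 + (q2 x * q3 y - q3 x * q2 y) ^+ 2.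
  by rewrite /quat_sqnorm /ip; ring.
by rewrite !addr_ge0 ?sqr_ge0.
Qed.
Fact quat_normZ (l : R) x : quat_norm (l *: x) = `|l| * quat_norm x.
Proof.
rewrite /quat_norm -sqrtr_sqr -sqrtrM ?sqr_ge0//; congr Num.sqrt.
by rewrite /quat_sqnorm /=; ring.
Qed.
Fact quat_norm0_eq0 x : quat_norm x = 0 -> x = 0.
Proof.
move=> /eqP; rewrite sqrtr_eq0 => x0; apply: quat_sqnorm_eq0.
by apply/eqP; rewrite eq_le x0 quat_sqnorm_ge0.
Qed.
HB.instance Definition _ := Lmodule_isNormed.Build R (quat R)
  quat_normD quat_normZ quat_norm0_eq0.

End QuatRing.

Section SliceHyperholomorphic.
Variable R : realType.
Implicit Types (p q : quat R) (U : set (quat R)).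

Definition qe1 : quat R := Quat 0 1 0 0.
Definition qe2 : quat R := Quat 0 0 1 0.
Definition qe3 : quat R := Quat 0 0 0 1.

Definition quat_im q : quat R := Quat 0 (q1 q) (q2 q) (q3 q).

Definition im_sphere : set (quat R) := [set I | q0 I = 0 /\ `|I| = 1].

Definition quat_class q : set (quat R) :=
  [set (q0 q)%:A + `|quat_im q| *: I | I in im_sphere].

Definition axially_symmetric U := forall q, U q -> quat_class q `<=` U.

Definition slice_domain U : set (R * R) :=
  [set w | forall I, im_sphere I -> U (w.1%:A + w.2 *: I)].

Definition du (h : R * R -> quat R) (w : R * R) : quat R := 'D_(1, 0) h w.
Definition dv (h : R * R -> quat R) (w : R * R) : quat R := 'D_(0, 1) h w.

(* Continuity of the partials is required at the points of A as points of the
   whole plane, which is C^1 regularity when A is open. *)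
Definition C1_on (A : set (R * R)) (h : R * R -> quat R) :=
  forall w, A w ->
    [/\ derivable h w (1, 0), derivable h w (0, 1),
        {for w, continuous (du h)} & {for w, continuous (dv h)}].

Definition left_slice_hyperholomorphic U (f : quat R -> quat R) :=
  exists alpha beta : R * R -> quat R,
    [/\ C1_on (slice_domain U) alpha /\ C1_on (slice_domain U) beta,
        (forall u v, slice_domain U (u, v) ->
           alpha (u, - v) = alpha (u, v) /\ beta (u, - v) = - beta (u, v)),
        (forall w, slice_domain U w ->
           du alpha w = dv beta w /\ dv alpha w = - du beta w) &
        (forall u v I, slice_domain U (u, v) -> im_sphere I ->
           f (u%:A + v *: I) = alpha (u, v) + I * beta (u, v))].

Definition cauchy_fueter (f : quat R -> quat R) q : quat R :=
  'D_1 f q + qe1 * 'D_qe1 f q + qe2 * 'D_qe2 f q + qe3 * 'D_qe3 f q.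

Definition Qp p q : quat R := q ^+ 2 - (2 * q0 p) *: q + (`|p| ^+ 2)%:A.

Definition cassini_shell p (R1 R2 : R) : set (quat R) :=
  [set q | R1 ^+ 2 < `|Qp p q| < R2 ^+ 2].

Definition calL (n : int) q p : quat R :=
  if 1 <= n then
    \sum_(0 <= k < `|n|%N) quat_conj (Qp p q ^ (n - 1 - k%:Z)) * Qp p q ^ k%:Z
  else if n == 0 then 0
  else - \sum_(0 <= k < `|n|%N)
           quat_conj (Qp p q ^ (- k%:Z - 1)) * Qp p q ^ (k%:Z + n).

(* A series over Z is the sum of its two halves, over n >= 0 and n < 0; note
   that Negz k = - (k + 1). *)
Definition zseries (F : int -> quat R) : quat R :=
  limn (series (fun k => F (Posz k))) + limn (series (fun k => F (Negz k))).

(* compactly_in U is the family of the compact subsets of U. *)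
Definition cvg_abs_unif_compacts U (F : int -> quat R -> quat R) :=
  [/\ forall q, U q -> summable [set: int] (fun n => (`|F n q|)%:E),
      {family compactly_in U,
         (fun m q => series (fun k => F (Posz k) q) m) @ \oo -->
         (fun q => limn (series (fun k => F (Posz k) q)))} &
      {family compactly_in U,
         (fun m q => series (fun k => F (Negz k) q) m) @ \oo -->
         (fun q => limn (series (fun k => F (Negz k) q)))}].

End SliceHyperholomorphic.

(* Main.v *)
Require Import Defs.
From HB Require Import structures.
From mathcomp Require Import all_boot all_order all_algebra.
From mathcomp Require Import all_classical all_reals all_analysis.
From mathcomp Require Import ring lra zify.

(* Put w = q - p_0, so that Q = Q_p(q) is w^2 plus a real constant. The
   derivative of Q^n in direction v is a sum of terms Q^i (v w + w v) Q^j, and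
   x + e_1 x e_1 + e_2 x e_2 + e_3 x e_3 = - 2 conj(x) turns the four directional
   derivatives into - 2 (w + conj(w)) L_n = - 4 (q_0 - p_0) L_n; the factor q - p
   of the odd terms contributes - 2 conj(Q^n) = - 2 Q_p(conj(q))^n. The two
   formulas are exchanged by the identity
   conj(Q)^n - Q^n = L_n (conj(Q) - Q) = 2 L_n (q_0 - p_0) (conj(q) - q).
   As |Q| takes every positive value, at points other than p, absolute convergence
   of the given series means that s^n |a_n| is summable over Z for all s between
   R_1^2 and R_2^2; hence so are the factors n s^n produced by differentiation,
   which gives majorants on compact sets, and dominated convergence of the
   difference quotients justifies termwise differentiation. *)

Set Implicit Arguments.
Unset Strict Implicit.
Unset Printing Implicit Defensive.

Import Order.TTheory GRing.Theory Num.Theory.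
Import numFieldNormedType.Exports.

Local Open Scope classical_set_scope.
Local Open Scope ring_scope.

(** * Multiplicativity of the quaternion norm, and algebra of conjugation *)

Section QuatNorm.
Variable R : realType.
Implicit Types x y z : quat R.

Lemma quat_normE x : `|x| = Num.sqrt (quat_sqnorm x).
Proof. by []. Qed.

Lemma sqr_quat_norm x : `|x| ^+ 2 = quat_sqnorm x.
Proof. by rewrite quat_normE sqr_sqrtr ?quat_sqnorm_ge0. Qed.

Lemma quat_normM : {morph (fun x => `|x|) : x y / x * y}.
Proof.
move=> x y; rewrite !quat_normE -sqrtrM ?quat_sqnorm_ge0//; congr Num.sqrt.
by rewrite /quat_sqnorm /=; ring.
Qed.

Lemma quat_norm1 : `|1 : quat R| = 1.
Proof.
by rewrite quat_normE /quat_sqnorm /= !expr0n /= !addr0 expr1n sqrtr1.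
Qed.

Lemma quat_normX x n : `|x ^+ n| = `|x| ^+ n.
Proof.
by elim: n => [|n IHn]; rewrite ?expr0 ?quat_norm1// !exprS quat_normM IHn.
Qed.

Lemma quat_unitE x : (x \is a GRing.unit) = (x != 0).
Proof. by []. Qed.

Lemma quat_normV x : `|x^-1| = `|x|^-1.
Proof.
have [->|x0] := eqVneq x 0.
  by rewrite invr_out ?quat_unitE ?eqxx// normr0 invr0.
apply: (mulfI (x := `|x|)); first by rewrite normr_eq0.
by rewrite -quat_normM divrr// quat_norm1 divff ?normr_eq0.
Qed.

Lemma quat_normXz x n : `|x ^ n| = `|x| ^ n.
Proof.
by case: n => n; rewrite ?NegzE -?exprnN -?exprnP ?quat_normV quat_normX.
Qed.

Lemma quat_conjD : {morph @quat_conj R : x y / x + y}.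
Proof. by move=> [????][????]; congr Quat => /=; ring. Qed.

Lemma quat_conjN : {morph @quat_conj R : x / - x}.
Proof. by move=> [????]; congr Quat. Qed.

Lemma quat_conjM x y : quat_conj (x * y) = quat_conj y * quat_conj x.
Proof. by case: x y => [????][????]; congr Quat => /=; ring. Qed.

Lemma quat_conjK : involutive (@quat_conj R).
Proof. by case=> ????; congr Quat => /=; ring. Qed.

Lemma quat_conj1 : quat_conj (1 : quat R) = 1.
Proof. by congr Quat => /=; rewrite oppr0. Qed.

Lemma quat_conjA (k : R) : quat_conj (k%:A) = k%:A.
Proof. by congr Quat => /=; ring. Qed.

Lemma quat_conjX x n : quat_conj (x ^+ n) = quat_conj x ^+ n.
Proof.
by elim: n => [|n IHn]; rewrite ?expr0 ?quat_conj1// exprS exprSr quat_conjM IHn.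
Qed.

Lemma quat_sqnorm_conj x : quat_sqnorm (quat_conj x) = quat_sqnorm x.
Proof. by rewrite /quat_sqnorm /=; ring. Qed.

Lemma quat_norm_conj x : `|quat_conj x| = `|x|.
Proof. by rewrite !quat_normE quat_sqnorm_conj. Qed.

Lemma quat_invE x : x^-1 = (`|x| ^+ 2)^-1 *: quat_conj x.
Proof. by rewrite sqr_quat_norm. Qed.

Lemma quat_conjV x : quat_conj x^-1 = (quat_conj x)^-1.
Proof.
rewrite !quat_invE quat_norm_conj quat_conjK.
by case: x => ????; congr Quat => /=; ring.
Qed.

Lemma quat_conjXz x n : quat_conj (x ^ n) = quat_conj x ^ n.
Proof.
by case: n => n; rewrite ?NegzE -?exprnN -?exprnP ?quat_conjV quat_conjX.
Qed.

Lemma quat_conjE x : quat_conj x = (2 * q0 x)%:A - x.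
Proof. by case: x => ????; congr Quat => /=; ring. Qed.

Lemma addr_quat_conj x : x + quat_conj x = (2 * q0 x)%:A.
Proof. by rewrite quat_conjE addrC subrK. Qed.

Lemma scalerA1_comm (k : R) x : GRing.comm k%:A x.
Proof. by rewrite /GRing.comm mulr_algl mulr_algr. Qed.

(** The conjugate of [y] is a real number minus [y], and real numbers are central. *)
Lemma quat_conj_comm x y : GRing.comm x y -> GRing.comm x (quat_conj y).
Proof.
move=> xy; rewrite quat_conjE; apply: commrB => //.
exact/commr_sym/scalerA1_comm.
Qed.

(* How the four directions combine in the Cauchy-Fueter operator. *)
Lemma sum_unit_conjugates x :
  x + qe1 R * x * qe1 R + qe2 R * x * qe2 R + qe3 R * x * qe3 R
  = - 2 * quat_conj x.
Proof.
rewrite mulNr mulr_natl mulr2n.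
by case: x => ????; congr Quat => /=; ring.
Qed.

End QuatNorm.

(** * Completeness of the quaternions and continuity of their operations *)

Section QuatTopology.
Variable R : realType.
Implicit Types x y z : quat R.

Let sqnorm_norm_le (c d : R) : 0 <= d -> `|c| <= Num.sqrt (c ^+ 2 + d).
Proof. by move=> d0; rewrite -sqrtr_sqr ler_sqrt ?addr_ge0 ?sqr_ge0// lerDl. Qed.

Lemma norm_q0_le x : `|q0 x| <= `|x|.
Proof.
rewrite quat_normE /quat_sqnorm -2!addrA.
by apply: sqnorm_norm_le; rewrite !addr_ge0 ?sqr_ge0.
Qed.

Lemma norm_q1_le x : `|q1 x| <= `|x|.
Proof.
rewrite quat_normE /quat_sqnorm.
rewrite (_ : _ + _ = q1 x ^+ 2 + (q0 x ^+ 2 + q2 x ^+ 2 + q3 x ^+ 2)); last by ring.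
by apply: sqnorm_norm_le; rewrite !addr_ge0 ?sqr_ge0.
Qed.

Lemma norm_q2_le x : `|q2 x| <= `|x|.
Proof.
rewrite quat_normE /quat_sqnorm.
rewrite (_ : _ + _ = q2 x ^+ 2 + (q0 x ^+ 2 + q1 x ^+ 2 + q3 x ^+ 2)); last by ring.
by apply: sqnorm_norm_le; rewrite !addr_ge0 ?sqr_ge0.
Qed.

Lemma norm_q3_le x : `|q3 x| <= `|x|.
Proof.
rewrite quat_normE /quat_sqnorm addrC.
by apply: sqnorm_norm_le; rewrite !addr_ge0 ?sqr_ge0.
Qed.

Lemma quat_norm_le x : `|x| <= `|q0 x| + `|q1 x| + `|q2 x| + `|q3 x|.
Proof.
have xE : x = (q0 x)%:A + q1 x *: qe1 R + q2 x *: qe2 R + q3 x *: qe3 R.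
  by case: x => ????; congr Quat => /=; ring.
have n1 i : quat_sqnorm i = 1 -> `|i| = 1 :> R.
  by move=> i1; rewrite quat_normE i1 sqrtr1.
have n_e1 : `|qe1 R| = 1 by apply: n1; rewrite /quat_sqnorm /=; ring.
have n_e2 : `|qe2 R| = 1 by apply: n1; rewrite /quat_sqnorm /=; ring.
have n_e3 : `|qe3 R| = 1 by apply: n1; rewrite /quat_sqnorm /=; ring.
rewrite {1}xE; do 3? (apply: le_trans (ler_normD _ _) _; apply: lerD).
all: by rewrite normrZ ?quat_norm1 ?n_e1 ?n_e2 ?n_e3 mulr1.
Qed.

Lemma quat_cvgP (T : Type) (F : set_system T) (FF : Filter F)
    (f : T -> quat R) x :
  q0 (f t) @[t --> F] --> q0 x -> q1 (f t) @[t --> F] --> q1 x ->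
  q2 (f t) @[t --> F] --> q2 x -> q3 (f t) @[t --> F] --> q3 x ->
  f @ F --> x.
Proof.
move=> /cvgr_dist_lt h0 /cvgr_dist_lt h1 /cvgr_dist_lt h2 /cvgr_dist_lt h3.
apply/cvgrPdist_lt => e e0.
have e4 : 0 < e / 4 by rewrite divr_gt0.
near=> t.
have H0 : `|q0 x - q0 (f t)| < e / 4 by near: t; exact: h0.
have H1 : `|q1 x - q1 (f t)| < e / 4 by near: t; exact: h1.
have H2 : `|q2 x - q2 (f t)| < e / 4 by near: t; exact: h2.
have H3 : `|q3 x - q3 (f t)| < e / 4 by near: t; exact: h3.
by apply: le_lt_trans (quat_norm_le _) _ => /=; lra.
Unshelve. all: by end_near. Qed.

(** The four components are additive and 1-Lipschitz, so each of them maps a Cauchy filter to a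
    Cauchy filter of [R]. Completeness makes absolutely convergent quaternionic series converge. *)
Lemma quat_cauchy_cvg (F : set_system (quat R)) :
  ProperFilter F -> cauchy F -> cvg F.
Proof.
move=> FF /cauchy_ballP Fc.
have comp (c : quat R -> R) : {morph c : x y / x - y} ->
    (forall x, `|c x| <= `|x|) -> cvg (c @ F).
  move=> cB cle; apply: cauchy_cvg; apply/cauchy_ballP => e e0.
  have [[A B] /= [FA FB] AB] := Fc e e0.
  exists (c @` A, c @` B) => /=.
    by split; [move: FA|move: FB]; apply: filterS => x ?; exists x.
  move=> [u v] /= [[x Ax <-] [y By <-]].
  have := AB (x, y) (conj Ax By).
  by rewrite -!ball_normE/= -cB; apply: le_lt_trans.
have /cvg_ex[l0 h0] := comp (@q0 R) (fun _ _ => erefl) norm_q0_le.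
have /cvg_ex[l1 h1] := comp (@q1 R) (fun _ _ => erefl) norm_q1_le.
have /cvg_ex[l2 h2] := comp (@q2 R) (fun _ _ => erefl) norm_q2_le.
have /cvg_ex[l3 h3] := comp (@q3 R) (fun _ _ => erefl) norm_q3_le.
by apply/cvg_ex; exists (Quat l0 l1 l2 l3); apply: quat_cvgP.
Qed.

HB.instance Definition _ := Uniform_isComplete.Build (quat R) quat_cauchy_cvg.

(** The components of a product are polynomials in the components of the factors, which reduces the
    claim to real limits. *)
Lemma quat_cvgM (T : Type) (F : set_system T) (FF : Filter F)
    (f g : T -> quat R) x y :
  f @ F --> x -> g @ F --> y -> f t * g t @[t --> F] --> x * y.
Proof.
have comp (c : quat R -> R) (cB : {morph c : x y / x - y})
    (cle : forall x, `|c x| <= `|x|) (h : T -> quat R) z :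
    h @ F --> z -> c (h t) @[t --> F] --> c z.
  move=> /cvgr_dist_lt hz; apply/cvgrPdist_lt => e e0.
  near=> t; rewrite -cB; apply: le_lt_trans (cle _) _; near: t; exact: hz.
move=> fx gy.
have := comp (@q0 R) (fun _ _ => erefl) norm_q0_le _ _ fx.
have := comp (@q1 R) (fun _ _ => erefl) norm_q1_le _ _ fx.
have := comp (@q2 R) (fun _ _ => erefl) norm_q2_le _ _ fx.
have := comp (@q3 R) (fun _ _ => erefl) norm_q3_le _ _ fx.
have := comp (@q0 R) (fun _ _ => erefl) norm_q0_le _ _ gy.
have := comp (@q1 R) (fun _ _ => erefl) norm_q1_le _ _ gy.
have := comp (@q2 R) (fun _ _ => erefl) norm_q2_le _ _ gy.
have := comp (@q3 R) (fun _ _ => erefl) norm_q3_le _ _ gy.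
move=> g3 g2 g1 g0 f3 f2 f1 f0; apply: quat_cvgP.
- exact: cvgB (cvgB (cvgB (cvgM f0 g0) (cvgM f1 g1)) (cvgM f2 g2)) (cvgM f3 g3).
- exact: cvgB (cvgD (cvgD (cvgM f0 g1) (cvgM f1 g0)) (cvgM f2 g3)) (cvgM f3 g2).
- exact: cvgD (cvgD (cvgB (cvgM f0 g2) (cvgM f1 g3)) (cvgM f2 g0)) (cvgM f3 g1).
- exact: cvgD (cvgB (cvgD (cvgM f0 g3) (cvgM f1 g2)) (cvgM f2 g1)) (cvgM f3 g0).
Unshelve. all: by end_near. Qed.

Lemma quat_cvg_conj (T : Type) (F : set_system T) (FF : Filter F)
    (f : T -> quat R) x :
  f @ F --> x -> quat_conj (f t) @[t --> F] --> quat_conj x.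
Proof.
move=> /cvgr_dist_lt fx; apply/cvgrPdist_lt => e e0; near=> t.
by rewrite -quat_conjN -quat_conjD quat_norm_conj; near: t; exact: fx.
Unshelve. all: by end_near. Qed.

Lemma quat_cvgX (T : Type) (F : set_system T) (FF : Filter F)
    (f : T -> quat R) x n : f @ F --> x -> f t ^+ n @[t --> F] --> x ^+ n.
Proof.
move=> fx; elim: n => [|n IHn]; first exact: cvg_cst.
by under eq_fun do rewrite exprS; rewrite exprS; apply: quat_cvgM.
Qed.

Lemma quat_cvgV (T : Type) (F : set_system T) (FF : Filter F)
    (f : T -> quat R) x : x != 0 ->
  f @ F --> x -> (f t)^-1 @[t --> F] --> x^-1.
Proof.
move=> x0 fx; under eq_fun do rewrite quat_invE.
rewrite quat_invE; apply: cvgZ; last exact: quat_cvg_conj.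
apply: cvgV; first by rewrite expf_neq0 ?normr_eq0.
under eq_fun do rewrite expr2; rewrite expr2.
by apply: cvgM; apply: cvg_norm.
Qed.

End QuatTopology.

(** * Series dominated by a convergent real series *)

Section DominatedSeries.
Variable R : realType.
Implicit Types (V : completeNormedModType R) (u : R ^nat).

Lemma dominated_is_cvg_series V (F : V ^nat) u :
  (forall n, `|F n| <= u n) -> cvgn (series u) -> cvgn (series F).
Proof.
move=> Fu cu; apply: normed_cvg.
apply: (@series_le_cvg R (fun n => `|F n|) u) => // n.
exact: le_trans (Fu n).
Qed.

(** The bound depends on [u] alone; this is the source of the uniformity in the two lemmas below. *)
Lemma dominated_series_tail V (F : V ^nat) u N :
  (forall n, `|F n| <= u n) -> cvgn (series u) ->
  `|limn (series F) - series F N| <= limn (series u) - series u N.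
Proof.
move=> Fu cu; have cF := dominated_is_cvg_series Fu cu.
have dF : (series F m - series F N) @[m --> \oo] -->
    limn (series F) - series F N by apply: cvgB cF _; exact: cvg_cst.
have du : (series u m - series u N) @[m --> \oo] -->
    limn (series u) - series u N by apply: cvgB cu _; exact: cvg_cst.
apply: (ler_cvg_to (cvg_norm dF) du).
near=> m; have Nm : (N <= m)%N by near: m; exact: nbhs_infty_ge.
rewrite !sub_series Nm; apply: le_trans (ler_norm_sum _ _ _) _.
exact: ler_sum.
Unshelve. all: by end_near. Qed.

(** The Weierstrass M-test. *)
Lemma dominated_uniform_cvg (T : choiceType) V (K : set T) (F : nat -> T -> V) u :
  (forall t n, K t -> `|F n t| <= u n) -> cvgn (series u) ->
  {uniform K, (fun m t => series (fun k => F k t) m) @ \oo -->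
              (fun t => limn (series (fun k => F k t)))}.
Proof.
move=> Fu cu P /uniform_nbhs[E [/= entE EP]].
have [e /= e0 eE] : exists2 e : R, 0 < e & [set xy | ball xy.1 e xy.2] `<=` E.
  by move: entE; rewrite -entourage_ballE => -[e /= e0 eE]; exists e.
have /cvgr_dist_lt/(_ _ e0) ue := cu.
apply: filterS ue => m um; apply: EP => t Kt /=; apply: eE => /=.
rewrite -ball_normE /=.
apply: le_lt_trans (dominated_series_tail m (fun n => Fu t n Kt) cu) _.
exact: le_lt_trans (ler_norm _) um.
Qed.

(* Tannery's theorem. *)
Lemma dominated_cvg_series (T : topologicalType) (Fl : set_system T)
    (FF : ProperFilter Fl) V (F : T -> V ^nat) (L : V ^nat) u :
  (forall n, F t n @[t --> Fl] --> L n) ->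
  (\forall t \near Fl, forall n, `|F t n| <= u n) -> cvgn (series u) ->
  limn (series (F t)) @[t --> Fl] --> limn (series L).
Proof.
move=> FL Fu cu.
have Lu n : `|L n| <= u n.
  have cst : (fun _ : T => u n) @ Fl --> u n by exact: cvg_cst.
  apply: (ler_cvg_to (cvg_norm (FL n)) cst). by apply: filterS Fu => t.
apply/cvgrPdist_lt => e e0.
have e3 : 0 < e / 3 by rewrite divr_gt0.
(* One [N] makes the tails of the limit series and of all dominated series smaller than [e / 3]; the
   last third is left to the finite sum of the first [N] terms. *)
have /cvgr_dist_lt/(_ _ e3)[N _ /(_ N (leqnn N)) /= uN] := cu.
have tail (G : V ^nat) : (forall n, `|G n| <= u n) ->
    `|limn (series G) - series G N| < e / 3.
  move=> Gu; apply: le_lt_trans (dominated_series_tail N Gu cu) _.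
  exact: le_lt_trans (ler_norm _) uN.
have /cvgr_dist_lt/(_ _ e3) sN : series (F t) N @[t --> Fl] --> series L N.
  rewrite /series /=; under eq_fun do rewrite big_mkord; rewrite big_mkord.
  by apply: cvg_big => [|i _]; [exact: add_continuous|exact: FL].
near=> t.
have h1 : `|limn (series L) - series L N| < e / 3 by exact: tail.
have h2 : `|series L N - series (F t) N| < e / 3 by near: t; exact: sN.
have h3 : `|limn (series (F t)) - series (F t) N| < e / 3.
  by apply: tail; near: t.
rewrite distrC in h3.
rewrite (_ : limn (series L) - limn (series (F t)) =
  (limn (series L) - series L N) + (series L N - series (F t) N) +
  (series (F t) N - limn (series (F t)))); last first.
  by rewrite !subrKA.
apply: le_lt_trans (ler_normD _ _) _.
have := ler_normD (limn (series L) - series L N) (series L N - series (F t) N).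
by move: h1 h2 h3; set a := `|_|; set b := `|_|; set c := `|_|; lra.
Unshelve. all: by end_near. Qed.

End DominatedSeries.

(** * Absolutely convergent series indexed by the integers *)

Section ZSeries.
Variable R : realType.
Implicit Types (F G : int -> quat R) (M : int -> R).

(** The two halves are those of [zseries]. For nonnegative [M] this is summability over the
    integers, by [summable_zsummable]. *)
Definition zsummable M :=
  cvgn (series (fun k => M (Posz k))) /\ cvgn (series (fun k => M (Negz k))).

Lemma nneg_esum_cvg (u : R ^nat) : (forall n, 0 <= u n) ->
  (\esum_(k in [set: nat]) (u k)%:E < +oo)%E <-> cvgn (series u).
Proof.
move=> u0; split=> [su|cu].
  have := @summable_cvg R xpredT (EFin \o u); rewrite /= => H.
  apply: H => [n _|]; first by rewrite lee_fin.
  rewrite /summable [X in esum X _](_ : _ = [set: nat]); last exact/seteqP.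
  by under eq_esum do rewrite gee0_abs ?lee_fin//.
rewrite -nneseries_esumT => [|n]; last by rewrite lee_fin.
under eq_fun do rewrite sumEFin.
by rewrite EFin_lim// ltry.
Qed.

Lemma summable_zsummable M : (forall n, 0 <= M n) ->
  summable [set: int] (fun n => (M n)%:E) <-> zsummable M.
Proof.
move=> M0; rewrite /summable.
under eq_esum do rewrite gee0_abs ?lee_fin//.
rewrite (esumID (range Posz)); last by move=> *; rewrite lee_fin.
rewrite setTI (_ : [set: int] `&` ~` range Posz = range Negz); last first.
  apply/seteqP; split => [[k|k] [_ /=]|k [n _ <-]] /=.
  - by case; exists k.
  - by exists k.
  - by split=> // -[].
rewrite !esum_image; [|by move=> ? ? _ _ []..].
rewrite /zsummable -!nneg_esum_cvg //.
have : (0 <= \esum_(k in [set: nat]) (M (Posz k))%:E)%E.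
  by apply: esum_ge0 => *; rewrite lee_fin.
have : (0 <= \esum_(k in [set: nat]) (M (Negz k))%:E)%E.
  by apply: esum_ge0 => *; rewrite lee_fin.
by do 2 case: (esum _ _) => [?||]//=; rewrite ?ltry //; intuition.
Qed.

Lemma zsummable_le M1 M2 : (forall n, 0 <= M1 n <= M2 n) ->
  zsummable M2 -> zsummable M1.
Proof.
move=> M12 [c1 c2]; split; [move: c1|move: c2]; apply: series_le_cvg => n;
  by have /andP[a b] := M12 (Posz n); have /andP[a' b'] := M12 (Negz n);
     rewrite ?(le_trans a b) ?(le_trans a' b').
Qed.

Lemma zsummableD M1 M2 :
  zsummable M1 -> zsummable M2 -> zsummable (fun n => M1 n + M2 n).
Proof. by move=> [? ?] [? ?]; split; apply: is_cvg_seriesD. Qed.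

Lemma zsummableZ c M : zsummable M -> zsummable (fun n => c * M n).
Proof. by move=> [? ?]; split; apply: is_cvg_seriesZ. Qed.

Lemma dominated_zsummable F M : (forall n, `|F n| <= M n) -> zsummable M ->
  zsummable (fun n => `|F n|).
Proof. by move=> FM; apply: zsummable_le => n; rewrite normr_ge0 FM. Qed.

Let zsummable_cvg F : zsummable (fun n => `|F n|) ->
  cvgn (series (fun k => F (Posz k))) /\ cvgn (series (fun k => F (Negz k))).
Proof. by move=> [? ?]; split; exact: normed_cvg. Qed.

Lemma zseriesD F G : zsummable (fun n => `|F n|) -> zsummable (fun n => `|G n|) ->
  zseries (fun n => F n + G n) = zseries F + zseries G.
Proof.
move=> /zsummable_cvg[? ?] /zsummable_cvg[? ?].
by rewrite /zseries !seriesD !limD// addrACA.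
Qed.

Lemma zseriesMl c F : zsummable (fun n => `|F n|) ->
  zseries (fun n => c * F n) = c * zseries F.
Proof.
move=> /zsummable_cvg[c1 c2].
have lim_mul (G : nat -> quat R) : cvgn (series G) ->
    limn (series (fun k => c * G k)) = c * limn (series G).
  move=> cG; apply/cvg_lim => //.
  rewrite (_ : series _ = fun n => c * series G n); last first.
    by apply/funext => n; rewrite /series /= mulr_sumr.
  by apply: quat_cvgM => //; exact: cvg_cst.
by rewrite /zseries !lim_mul// mulrDr.
Qed.

Lemma zseries_lin c d F G : zsummable (fun n => `|F n|) ->
  zsummable (fun n => `|G n|) ->
  zseries (fun n => c * F n + d * G n) = c * zseries F + d * zseries G.
Proof.
have sM (e : quat R) (H : int -> quat R) :
    zsummable (fun n => `|H n|) -> zsummable (fun n => `|e * H n|).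
  move=> /(zsummableZ `|e|); apply: zsummable_le => n.
  by rewrite quat_normM lexx mulr_ge0.
move=> sF sG; rewrite -(zseriesMl _ sF) -(zseriesMl _ sG).
exact: zseriesD (sM _ _ sF) (sM _ _ sG).
Qed.

(** Tannery's theorem on each half; it will be applied to difference quotients. *)
Lemma dominated_cvg_zseries (T : topologicalType) (Fl : set_system T)
    (FF : ProperFilter Fl) (F : T -> int -> quat R) (L : int -> quat R) M :
  (forall n, F t n @[t --> Fl] --> L n) ->
  (\forall t \near Fl, forall n, `|F t n| <= M n) -> zsummable M ->
  zseries (F t) @[t --> Fl] --> zseries L.
Proof.
move=> FL FM [c1 c2]; apply: cvgD.
- apply: (@dominated_cvg_series R T Fl FF _ (fun t k => F t (Posz k))
    (fun k => L (Posz k)) _ _ _ c1) => [n|]; first exact: FL.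
  by apply: filterS FM => t Ft n; exact: Ft.
- apply: (@dominated_cvg_series R T Fl FF _ (fun t k => F t (Negz k))
    (fun k => L (Negz k)) _ _ _ c2) => [n|]; first exact: FL.
  by apply: filterS FM => t Ft n; exact: Ft.
Qed.

(** The M-test on each compact set gives the uniform convergence; singletons, being compact, give
    absolute convergence at each point. *)
Lemma dominated_cvg_abs_unif (U : set (quat R)) (F : int -> quat R -> quat R) :
  (forall K, compact K -> K `<=` U ->
    exists2 M, zsummable M & forall n q, K q -> `|F n q| <= M n) ->
  cvg_abs_unif_compacts U F.
Proof.
move=> dom; split.
- move=> q Uq; apply/summable_zsummable => //.
  have [|M cM FM] := dom _ (@compact_set1 _ q); first by move=> _ ->.
  by apply: dominated_zsummable cM => n; exact: FM.
- apply/fam_cvgP => K [KU cK]; have [M [c1 c2] FM] := dom K cK KU.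
  by apply: (dominated_uniform_cvg _ c1) => q n; exact: FM.
- apply/fam_cvgP => K [KU cK]; have [M [c1 c2] FM] := dom K cK KU.
  by apply: (dominated_uniform_cvg _ c2) => q n; exact: FM.
Qed.

End ZSeries.

(** * Divided differences of integer powers, and their Cauchy-Fueter sums *)

Section DividedDifference.
Variable R : realType.
Implicit Types (x y z w : quat R) (n : int).

(* The noncommutative divided difference of [x ^ n]: with [z = x - y] it is
   [x ^ n - y ^ n], with [x = y] the differential of the power in direction [z],
   and with [x = quat_conj y], [z = 1] it is the kernel [calL]. *)
Definition dpow n x y z : quat R :=
  match n with
  | Posz m => \sum_(0 <= k < m) x ^+ (m - k.+1) * z * y ^+ k
  | Negz m => - \sum_(0 <= k < m.+1) x^-1 ^+ k.+1 * z * y^-1 ^+ (m.+1 - k)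
  end.

(** Inserting [x - y] makes the sum telescope, through the products [x ^+ (m - k) * y ^+ k] when
    [n = m >= 0] and through [x^-1 ^+ k * y^-1 ^+ (m.+1 - k)] when [n = - m.+1]. *)
Lemma dpow_sub n x y : x != 0 -> y != 0 -> dpow n x y (x - y) = x ^ n - y ^ n.
Proof.
rewrite -!quat_unitE => x0 y0; case: n => m /=.
  rewrite -[LHS]opprK -sumrN.
  rewrite (@telescope_sumr_eq _ 0 m (fun k => x ^+ (m - k) * y ^+ k))//.
    by rewrite subnn subn0 !expr0 mul1r mulr1 opprB.
  move=> k /= km; rewrite mulrBr mulrBl opprB -exprSr -(subSn km) subSS.
  by rewrite -mulrA -exprS.
rewrite NegzE -!exprnN -!exprVn -sumrN.
rewrite (@telescope_sumr_eq _ 0 m.+1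
  (fun k => x^-1 ^+ k * y^-1 ^+ (m.+1 - k)))//.
  by rewrite subnn subn0 !expr0 mul1r mulr1.
move=> k /= km; rewrite mulrBr mulrBl opprB exprSr (mulrVK x0).
by rewrite (@subSn k m km) exprS !mulrA mulrK// subSS.
Qed.

Lemma dpow_comm n x y z : GRing.comm z y -> dpow n x y z = dpow n x y 1 * z.
Proof.
move=> zy; case: n => m /=; rewrite ?mulNr mulr_suml; [|congr (- _)];
  apply: eq_bigr => k _; rewrite mulr1 -!mulrA; congr (_ * _).
  exact: commrX.
by apply/commrX/commrV.
Qed.

Lemma dpowZ n x y z (c : R) : dpow n x y (c *: z) = c *: dpow n x y z.
Proof.
by case: n => m /=; rewrite ?scalerN scaler_sumr; [|congr (- _)];
  apply: eq_bigr => k _; rewrite -scalerAr -scalerAl.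
Qed.

Lemma dpow_cvg (T : Type) (F : set_system T) (FF : Filter F)
    (f g : T -> quat R) n x y z : x != 0 -> f @ F --> x -> g @ F --> z ->
  dpow n (f t) y (g t) @[t --> F] --> dpow n x y z.
Proof.
move=> x0 fx gz; case: n => m /=; [|apply: cvgN];
  apply: cvg_big => [|k _]; try exact: add_continuous;
  apply: quat_cvgM; try exact: cvg_cst; apply: quat_cvgM => //;
  apply: quat_cvgX => //; exact: quat_cvgV.
Qed.

(** There are [|n|] summands, each of total degree [n - 1] in [x] and [y]; hence the exponent [m.-1]
    for positive [n], and [|n|.+1] on [r1^-1] for negative [n]. *)
Lemma dpow_bound n x y z (r1 r2 : R) : 0 < r1 ->
  r1 <= `|x| <= r2 -> r1 <= `|y| <= r2 ->
  `|dpow n x y z| <= `|n|%:R * (if n is Posz m then r2 ^+ m.-1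
                               else r1^-1 ^+ `|n|.+1) * `|z|.
Proof.
move=> r10 /andP[x1 x2] /andP[y1 y2].
have inv_le (u : quat R) : r1 <= `|u| -> `|u^-1| <= r1^-1.
  by move=> ru; rewrite quat_normV lef_pV2 ?posrE// (lt_le_trans r10).
have term (r : R) (u v : quat R) i j k : `|u| <= r -> `|v| <= r -> (i + j = k)%N ->
    `|u ^+ i * z * v ^+ j| <= r ^+ k * `|z|.
  move=> ur vr <-; rewrite !quat_normM !quat_normX mulrAC.
  by rewrite exprD ler_wpM2r// ler_pM ?exprn_ge0// lerXn2r ?nnegrE// (le_trans _ ur).
have const (c : R) m : \sum_(0 <= k < m) c = m%:R * c.
  by rewrite big_const_nat iter_addr_0 subn0 mulr_natl.
rewrite -mulrA; case: n => m; rewrite /= ?normrN -const.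
  rewrite !big_nat; apply: le_trans (ler_norm_sum _ _ _) _.
  by apply: ler_sum => k km; apply: term => //; lia.
rewrite !big_nat; apply: le_trans (ler_norm_sum _ _ _) _.
by apply: ler_sum => k km; apply: term; [exact: inv_le..|lia].
Qed.

(** The Cauchy-Fueter operator as a function of the differential: [cauchy_fueter f q] is the case
    where [L v] is the derivative of [f] at [q] in direction [v]. *)
Definition fueter_sum (L : quat R -> quat R) : quat R :=
  L 1 + qe1 R * L (qe1 R) + qe2 R * L (qe2 R) + qe3 R * L (qe3 R).

Lemma fueter_sumD L1 L2 :
  fueter_sum (fun v => L1 v + L2 v) = fueter_sum L1 + fueter_sum L2.
Proof.
by rewrite /fueter_sum !mulrDr; do 3 (rewrite [RHS]addrACA; congr (_ + _)).
Qed.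

Lemma fueter_sumMr L c : fueter_sum (fun v => L v * c) = fueter_sum L * c.
Proof. by rewrite /fueter_sum !mulrDl !mulrA. Qed.

Lemma fueter_sumN L : fueter_sum (fun v => - L v) = - fueter_sum L.
Proof. by rewrite /fueter_sum !mulrN !opprD. Qed.

Lemma fueter_sum_sum (I : Type) (r : seq I) (L : I -> quat R -> quat R) :
  fueter_sum (fun v => \sum_(i <- r) L i v) = \sum_(i <- r) fueter_sum (L i).
Proof. by rewrite /fueter_sum !mulr_sumr !big_split. Qed.

Lemma eq_fueter_sum L1 L2 : L1 =1 L2 -> fueter_sum L1 = fueter_sum L2.
Proof. by move=> e; rewrite /fueter_sum !e. Qed.

Lemma fueter_sumMl c : fueter_sum (fun v => c * v) = - 2 * quat_conj c.
Proof. by rewrite /fueter_sum mulr1 !mulrA sum_unit_conjugates. Qed.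

(** In a summand [c * (v * w + w * v) * b], where [c] is a power of [x] and so commutes with [w],
    the part [c * v * w] sums to [- 2 * quat_conj c * w] and the part [c * w * v] to
    [- 2 * quat_conj c * quat_conj w]. Thus only the powers of [x] on the left get conjugated. *)
Lemma fueter_sum_dpow n x w : GRing.comm x w ->
  fueter_sum (fun v => dpow n x x (v * w + w * v))
  = - 2 * dpow n (quat_conj x) x (w + quat_conj w).
Proof.
move=> xw.
have term c b : GRing.comm c w ->
    fueter_sum (fun v => c * (v * w + w * v) * b)
    = - 2 * (quat_conj c * (w + quat_conj w) * b).
  move=> cw; rewrite fueter_sumMr.
  rewrite (@eq_fueter_sum _ (fun v => c * v * w + c * w * v)); last first.
    by move=> v; rewrite mulrDr !mulrA.
  rewrite fueter_sumD fueter_sumMr !fueter_sumMl cw quat_conjM.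
  by rewrite -[_ * quat_conj c * w]mulrA -mulrDr -mulrDr !mulrA.
case: n => m /=.
  rewrite fueter_sum_sum mulr_sumr; apply: eq_bigr => k _.
  by rewrite term ?quat_conjX//; apply/commr_sym/commrX/commr_sym.
rewrite fueter_sumN fueter_sum_sum mulrN mulr_sumr; congr (- _).
apply: eq_bigr => k _.
by rewrite term ?quat_conjX ?quat_conjV//; apply/commr_sym/commrX/commrV/commr_sym.
Qed.

End DividedDifference.

(** * Summable majorants for powers and their divided differences *)

Section Majorant.
Variable R : realType.

(** Each of the [m] terms of the geometric sum [(1 - t ^+ m) / (1 - t)] is at least [t ^+ m]. *)
Lemma natrX_bounded (t : R) m : 0 <= t < 1 -> m%:R * t ^+ m <= (1 - t)^-1.
Proof.
move=> /andP[t0 t1]; have t10 : 0 < 1 - t by rewrite subr_gt0.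
rewrite -[leRHS]mul1r ler_pdivlMr//.
have : 1 - t ^+ m <= 1 by rewrite gerBl exprn_ge0.
have -> : 1 - t ^+ m = (1 - t) * \sum_(i < m) t ^+ i.
  by rewrite -[LHS]opprB subrX1 -mulNr opprB.
apply: le_trans; rewrite mulrC; apply: ler_wpM2l (ltW t10) _ _ _.
rewrite mulr_natl -[X in _ *+ X]subn0 -sumr_const_nat big_mkord.
apply: ler_sum => i _.
exact: ler_wiXn2l t0 (ltW t1) _ _ (ltnW (ltn_ord i)).
Qed.

(** Summability is used at two radii only, [s1] between [A1] and [r1] for negative [n] and [s2]
    between [r2] and [A2] for positive [n]. The gaps to [r1] and [r2] absorb the factor [|n|]. *)
Lemma dpow_majorant (A1 A2 r1 r2 : R) (b : int -> quat R) :
  0 <= A1 -> A1 < r1 -> r1 <= r2 -> r2 < A2 ->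
  (forall s, A1 < s < A2 -> zsummable (fun n => s ^ n * `|b n|)) ->
  exists2 M, zsummable M &
    (forall n (x : quat R), r1 <= `|x| <= r2 -> `|x ^ n| * `|b n| <= M n) /\
    (forall n x y z, r1 <= `|x| <= r2 -> r1 <= `|y| <= r2 ->
       `|dpow n x y z| * `|b n| <= M n * `|z|).
Proof.
move=> A10 A1r r12 rA2 sb.
pose s1 := (A1 + r1) / 2; pose s2 := (r2 + A2) / 2.
have s10 : 0 < s1 by rewrite /s1; lra.
have s1r : s1 < r1 by rewrite /s1; lra.
have rs2 : r2 < s2 by rewrite /s2; lra.
have r10 : 0 < r1 by lra.
have r20 : 0 < r2 by lra.
have s20 : 0 < s2 by lra.
(* The first factors come from [natrX_bounded] for the ratios [s1 / r1] and [r2 / s2]; the extra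
   inverse radius is there because [dpow_bound] has degree [n - 1], not [n]. *)
pose C1 := (1 - s1 / r1)^-1 * r1^-1; pose C2 := (1 - r2 / s2)^-1 * r2^-1.
have t1 : 0 <= s1 / r1 < 1.
  by rewrite divr_ge0 ?ltW//= ltr_pdivrMr// mul1r.
have t2 : 0 <= r2 / s2 < 1.
  by rewrite divr_ge0 ?ltW//= ltr_pdivrMr// mul1r.
have C10 : 0 <= C1 by rewrite mulr_ge0 ?invr_ge0 ?subr_ge0 ?ltW//; case/andP: t1.
have C20 : 0 <= C2 by rewrite mulr_ge0 ?invr_ge0 ?subr_ge0 ?ltW//; case/andP: t2.
(* Adding both radii and all constants gives one formula for both signs of [n]; the constant 1
   serves the bare powers [x ^ n]. *)
exists (fun n => (1 + C1 + C2) * (s1 ^ n * `|b n| + s2 ^ n * `|b n|)).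
  by apply/zsummableZ/zsummableD; apply: sb; rewrite /s1 /s2; lra.
have p1 n : 0 <= s1 ^ n by rewrite exprz_ge0 ?ltW.
have p2 n : 0 <= s2 ^ n by rewrite exprz_ge0 ?ltW.
have big c n : c <= 1 + C1 + C2 -> forall e, 0 <= c -> e <= s1 ^ n + s2 ^ n ->
    c * e * `|b n| <= (1 + C1 + C2) * (s1 ^ n * `|b n| + s2 ^ n * `|b n|).
  move=> cC e c0 es; rewrite -mulrDl mulrA ler_wpM2r//.
  apply: le_trans (ler_wpM2l c0 es) _.
  by rewrite ler_wpM2r// addr_ge0.
split=> [n x /andP[x1 x2]|n x y z rx ry].
  rewrite -[`|x ^ n|]mul1r; apply: big; [lra|lra|].
  rewrite quat_normXz; have x0 : 0 < `|x| by lra.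
  case: n => m; rewrite ?NegzE -?exprnN -?exprnP.
    have : `|x| ^+ m <= s2 ^+ m by rewrite lerXn2r ?nnegrE; lra.
    by have := exprn_ge0 m (ltW s10); lra.
  have : `|x| ^- m.+1 <= s1 ^- m.+1.
    by rewrite lef_pV2 ?posrE ?exprn_gt0// lerXn2r ?nnegrE; lra.
  have : 0 <= s2 ^- m.+1 by rewrite invr_ge0 exprn_ge0 ?ltW.
  by lra.
apply: le_trans (ler_wpM2r (normr_ge0 (b n)) (dpow_bound n z r10 rx ry)) _.
rewrite mulrAC ler_wpM2r//.
case: n => [[|m]|m] /=.
- rewrite mulr0n !mul0r; apply: mulr_ge0; first lra.
  by rewrite -mulrDl mulr_ge0 ?addr_ge0.
- have -> : m.+1%:R * r2 ^+ m
      = m.+1%:R * (r2 / s2) ^+ m.+1 * (r2^-1 * s2 ^+ m.+1).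
    by rewrite expr_div_n exprS; field; rewrite ?expf_neq0 ?gt_eqF.
  apply: le_trans (big C2 m.+1 _ (s2 ^+ m.+1) _ _) => //; [|lra|].
    rewrite /C2 ler_wpM2r// -[leRHS]mulrA ler_wpM2r ?natrX_bounded//.
    by rewrite mulr_ge0 ?invr_ge0 ?exprn_ge0 ?ltW.
  by rewrite -exprnP lerDr exprn_ge0 ?ltW.
- have -> : m.+1%:R * r1^-1 ^+ m.+2
      = m.+1%:R * (s1 / r1) ^+ m.+1 * (r1^-1 * s1 ^- m.+1).
    rewrite expr_div_n (exprS _ m.+1) exprVn.
    by field; rewrite ?expf_neq0 ?gt_eqF.
  apply: le_trans (big C1 (Negz m) _ (s1 ^- m.+1) _ _) => //; [|lra|].
    rewrite /C1 ler_wpM2r// -[leRHS]mulrA ler_wpM2r ?natrX_bounded//.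
    by rewrite mulr_ge0 ?invr_ge0 ?exprn_ge0 ?ltW.
  by rewrite NegzE -!exprnN lerDl invr_ge0 exprn_ge0 ?ltW.
Qed.

End Majorant.

(** * The polynomial [Qp], the kernel [calL] and Cassini shells *)

Section CassiniPolynomial.
Variable R : realType.
Implicit Types (p q v : quat R) (n : int).

Lemma QpE p q :
  Qp p q = (q - (q0 p)%:A) ^+ 2 + (`|p| ^+ 2 - q0 p ^+ 2)%:A.
Proof.
rewrite /Qp sqr_quat_norm expr2 (expr2 (q - _)).
by case: p q => [????][????]; rewrite /quat_sqnorm; congr Quat => /=; ring.
Qed.

Lemma Qp_conj p q : Qp p (quat_conj q) = quat_conj (Qp p q).
Proof.
by rewrite !QpE quat_conjD quat_conjX quat_conjD quat_conjN !quat_conjA.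
Qed.

Lemma Qp_comm p q : GRing.comm (Qp p q) (q - (q0 p)%:A).
Proof.
rewrite QpE; apply/commr_sym; apply: commrD; first exact: commrX.
exact/commr_sym/scalerA1_comm.
Qed.

(** An exact expansion rather than a limit: after division by [h] it supplies the last argument of
    [dpow] in the difference quotients. *)
Lemma Qp_shift p q v (h : R) :
  Qp p (h *: v + q) - Qp p q
  = h *: (v * (q - (q0 p)%:A) + (q - (q0 p)%:A) * v + h *: (v * v)).
Proof.
rewrite !QpE opprD addrACA subrr addr0 -addrA !expr2.
by move: (q - _) => w; case: v w => [????][????]; congr Quat => /=; ring.
Qed.

Lemma calLE n q p : calL n q p = dpow n (quat_conj (Qp p q)) (Qp p q) 1.
Proof.
rewrite /calL; case: n => [[|m]|m] //=.
- by rewrite big_geq.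
- apply: eq_big_nat => k /= km; rewrite mulr1 quat_conjXz.
  by rewrite (_ : Posz m.+1 - 1 - Posz k = Posz (m.+1 - k.+1)) //; lia.
- congr (- _); apply: eq_big_nat => k /= km.
  rewrite mulr1 quat_conjXz; congr (_ * _).
    by rewrite (_ : - Posz k - 1 = Negz k) ?NegzE -?exprnN ?exprVn//; lia.
  by rewrite (_ : Posz k + Negz m = - Posz (m.+1 - k)) -?exprnN ?exprVn//; lia.
Qed.

(** This is [dpow_sub] at the conjugate of [Qp p q] and [Qp p q] itself. Their difference commutes
    with [Qp p q], so [dpow_comm] pulls it out and leaves the kernel. *)
Lemma calL_conj_sub n q p : Qp p q != 0 ->
  quat_conj (Qp p q ^ n) - Qp p q ^ n
  = calL n q p * (2 * (q0 q - q0 p))%:A * (quat_conj q - q).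
Proof.
move=> Q0; set w := q - (q0 p)%:A.
have cQ0 : quat_conj (Qp p q) != 0.
  by apply: contra_neq Q0 => cQ; rewrite -[LHS]quat_conjK cQ;
    congr Quat; rewrite /= oppr0.
rewrite quat_conjXz -dpow_sub// -Qp_conj.
have -> : Qp p (quat_conj q) - Qp p q
    = (2 * (q0 q - q0 p))%:A * (quat_conj q - q).
  rewrite /Qp !expr2.
  by case: (p) (q) => [????][????]; congr Quat => /=; ring.
rewrite Qp_conj dpow_comm -?calLE ?mulrA//.
apply/commr_sym/commrM; first exact/commr_sym/scalerA1_comm.
have Qq : GRing.comm (Qp p q) q.
  rewrite -[q in GRing.comm _ q](subrK (q0 p)%:A); apply: commrD (Qp_comm p q) _.
  exact/commr_sym/scalerA1_comm.
by apply: commrB => //; exact: quat_conj_comm.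
Qed.

(** With [w] for [q] minus the real part of [p], the sum of [w] and its conjugate is the real number
    [2 * (q0 q - q0 p)], which leaves [dpow] as a central factor. *)
Lemma fueter_sum_Qp n p q :
  fueter_sum (fun v => dpow n (Qp p q) (Qp p q)
                        (v * (q - (q0 p)%:A) + (q - (q0 p)%:A) * v))
  = - 4 * (calL n q p * (q0 q - q0 p)%:A).
Proof.
rewrite fueter_sum_dpow; last exact: Qp_comm.
rewrite addr_quat_conj dpow_comm; last exact: scalerA1_comm.
rewrite -calLE (_ : (2 * _)%:A = 2 * (q0 q - q0 p)%:A :> quat R); last first.
  by rewrite mulr_natl mulr2n; congr Quat => /=; ring.
by rewrite mulr_natl !mulrnAr -mulrnAl mulNrn -mulrnA.
Qed.

Lemma norm_Qp_cvg (T : Type) (F : set_system T) (FF : Filter F) p q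
    (f : T -> quat R) : f @ F --> q -> `|Qp p (f t)| @[t --> F] --> `|Qp p q|.
Proof.
move=> fq; apply: cvg_norm; under eq_fun do rewrite QpE; rewrite QpE.
apply: cvgD; last exact: cvg_cst.
by apply: quat_cvgX; apply: cvgB fq _; exact: cvg_cst.
Qed.

Lemma cassini_compact p (R1 R2 : R) (K : set (quat R)) : 0 < R1 -> R1 < R2 ->
  compact K -> K `<=` cassini_shell p R1 R2 ->
  exists r1 r2 B, [/\ R1 ^+ 2 < r1, r1 <= r2, r2 < R2 ^+ 2, 0 <= B &
    forall q, K q -> r1 <= `|Qp p q| <= r2 /\ `|q| <= B].
Proof.
move=> R10 R12 cK KS.
(* The extreme value theorem needs a point of [K]; for empty [K] any radius strictly inside the
   shell will do. *)
have [->|/set0P K0] := eqVneq K set0.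
  exists ((R1 ^+ 2 + R2 ^+ 2) / 2), ((R1 ^+ 2 + R2 ^+ 2) / 2), 0.
  have : R1 ^+ 2 < R2 ^+ 2 by rewrite ltr_pXn2r ?nnegrE //; lra.
  by split => //; lra.
have cQ : {within K, continuous (fun q => `|Qp p q|)}.
  by apply: continuous_subspaceT => q; apply: (@norm_Qp_cvg _ (nbhs q) _ p q id).
have cN : {within K, continuous (fun q : quat R => `|q|)}.
  by apply: continuous_subspaceT => q; exact: norm_continuous.
have [x1 /set_mem Kx1 min1] := compact_EVT_min K0 cK cQ.
have [x2 /set_mem Kx2 max2] := compact_EVT_max K0 cK cQ.
have [x3 /set_mem Kx3 max3] := compact_EVT_max K0 cK cN.
have /andP[a1 _] := KS _ Kx1; have /andP[_ a2] := KS _ Kx2.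
exists `|Qp p x1|, `|Qp p x2|, `|x3|; split => //.
  by apply: min1; exact: mem_set.
by move=> q /mem_set Kq; rewrite min1 ?max2 ?max3.
Qed.

End CassiniPolynomial.

(** * Termwise differentiation of the spherical Laurent series *)

Section LaurentDerivative.
Variable R : realType.
Implicit Types (p q v : quat R) (n : int).

(** Here [m] is the squared norm of the imaginary part of [p]. Moving from the real part of [p] by
    the square root of [m + s] along [qe1] gives [Qp p q = - s], whereas [Qp p p = 0]. *)
Lemma cassini_level p (s : R) : 0 < s -> exists2 q, `|Qp p q| = s & q != p.
Proof.
move=> s0; set m := `|p| ^+ 2 - q0 p ^+ 2.
have m0 : 0 <= m.
  rewrite /m sqr_quat_norm /quat_sqnorm.
  rewrite (_ : _ - _ = q1 p ^+ 2 + q2 p ^+ 2 + q3 p ^+ 2).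
    by rewrite !addr_ge0 ?sqr_ge0.
  by ring.
pose q := (q0 p)%:A + Num.sqrt (m + s) *: qe1 R.
have Qq : `|Qp p q| = s.
  rewrite QpE -/m (_ : _ + _ = (m - Num.sqrt (m + s) ^+ 2)%:A).
    have ms : 0 <= m + s by lra.
    by rewrite sqr_sqrtr// opprD addrA subrr add0r normrZ quat_norm1 mulr1
      normrN gtr0_norm.
  by rewrite (expr2 (_ - _)) expr2; congr Quat => /=; ring.
exists q => //; apply: contraTneq s0 => qp.
rewrite -Qq qp (_ : Qp p p = 0) ?normr0 ?ltxx// /Qp sqr_quat_norm expr2.
by case: (p) => ????; rewrite /quat_sqnorm; congr Quat => /=; ring.
Qed.

(** The norm is multiplicative, so at a point with [|Qp p q| = s] other than [p] the nonzero factor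
    [|c q|] can be divided out. *)
Lemma laurent_coef_zsummable p (R1 R2 : R) (c : quat R -> quat R)
    (b : int -> quat R) : (forall q, q != p -> c q != 0) ->
  (forall q, cassini_shell p R1 R2 q ->
     zsummable (fun n => `|Qp p q ^ n * c q * b n|)) ->
  forall s, R1 ^+ 2 < s < R2 ^+ 2 -> zsummable (fun n => s ^ n * `|b n|).
Proof.
move=> c0 sb s sR; have s0 : 0 < s.
  by case/andP: sR => + _; apply: le_lt_trans; exact: sqr_ge0.
have [q qs qp] := cassini_level p s0.
have := sb q; rewrite /cassini_shell /= qs => /(_ sR) /(@zsummableZ _ `|c q|^-1).
apply: zsummable_le => n; rewrite !quat_normM quat_normXz qs.
rewrite [_ * _ * `|b n|]mulrAC mulrCA mulVf ?normr_eq0 ?c0// mulr1 lexx andbT.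
by rewrite mulr_ge0// exprz_ge0// ltW.
Qed.

Variables (p : quat R) (R1 R2 : R) (a b : int -> quat R).
Hypothesis a_summable : forall s, R1 ^+ 2 < s < R2 ^+ 2 ->
  zsummable (fun n => s ^ n * `|a n|).
Hypothesis b_summable : forall s, R1 ^+ 2 < s < R2 ^+ 2 ->
  zsummable (fun n => s ^ n * `|b n|).
Hypotheses (R10 : 0 < R1) (R12 : R1 < R2).

Let S := cassini_shell p R1 R2.

Definition laurent_term n q := Qp p q ^ n * a n + Qp p q ^ n * (q - p) * b n.

(** The derivative of [laurent_term n] at [q] in direction [v], by the product rule; [z] is the
    derivative of [Qp p] in that direction. *)
Definition laurent_diff q n v :=
  let z := v * (q - (q0 p)%:A) + (q - (q0 p)%:A) * v in
  dpow n (Qp p q) (Qp p q) z * a n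
  + (dpow n (Qp p q) (Qp p q) z * (q - p) + Qp p q ^ n * v) * b n.

Let majorants (r1 r2 : R) : R1 ^+ 2 < r1 -> r1 <= r2 -> r2 < R2 ^+ 2 ->
  exists Ma Mb, [/\ zsummable Ma, zsummable Mb, forall n, 0 <= Mb n &
   (forall n (x : quat R), r1 <= `|x| <= r2 ->
     `|x ^ n * a n| <= Ma n /\ `|x ^ n| * `|b n| <= Mb n) /\
   (forall n x y z, r1 <= `|x| <= r2 -> r1 <= `|y| <= r2 ->
     `|dpow n x y z * a n| <= Ma n * `|z| /\
     `|dpow n x y z| * `|b n| <= Mb n * `|z|)].
Proof.
move=> h1 h12 h2.
have [Ma sa [a1 a2]] := dpow_majorant (sqr_ge0 R1) h1 h12 h2 a_summable.
have [Mb sb [b1 b2]] := dpow_majorant (sqr_ge0 R1) h1 h12 h2 b_summable.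
exists Ma, Mb; split => //.
  (* The sign of [Mb n] is read off its bound at the real quaternion [r1]. *)
  move=> n; have r10 : 0 <= r1 by apply: le_trans (ltW h1); exact: sqr_ge0.
  have := b1 n r1%:A; rewrite normrZ quat_norm1 mulr1 ger0_norm// lexx h12.
  by move=> /(_ isT); apply: le_trans; rewrite mulr_ge0.
split=> [n x xr|n x y z xr yr]; rewrite quat_normM.
  by split; [exact: a1|exact: b1].
by split; [exact: a2|exact: b2].
Qed.

Let shell_R q : S q -> R1 ^+ 2 < `|Qp p q| < R2 ^+ 2. Proof. by []. Qed.

Lemma shell_Qp_neq0 q : S q -> Qp p q != 0.
Proof.
case/andP=> + _; apply: contraTneq => ->.
by rewrite normr0 -leNgt sqr_ge0.
Qed.

Lemma laurent_term_zsummable q : S q -> zsummable (fun n => `|laurent_term n q|).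
Proof.
move=> /shell_R/andP[q1 q2].
have qq : `|Qp p q| <= `|Qp p q| <= `|Qp p q| by rewrite lexx.
have [Ma [Mb [sa sb _ [pw _]]]] := majorants q1 (lexx _) q2.
apply: (dominated_zsummable (M := fun n => Ma n + `|q - p| * Mb n)).
  move=> n; have [ha hb] := pw n _ qq.
  apply: le_trans (ler_normD _ _) _; apply: lerD => //.
  by rewrite !quat_normM mulrAC mulrC ler_wpM2l.
exact/zsummableD/zsummableZ.
Qed.

Lemma laurent_diff_zsummable q v : S q ->
  zsummable (fun n => `|laurent_diff q n v|).
Proof.
move=> /shell_R/andP[q1 q2].
have qq : `|Qp p q| <= `|Qp p q| <= `|Qp p q| by rewrite lexx.
have [Ma [Mb [sa sb Mb0 [pw dp]]]] := majorants q1 (lexx _) q2.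
set w := q - (q0 p)%:A; pose z := v * w + w * v.
apply: (dominated_zsummable
  (M := fun n => `|z| * Ma n + (`|z| * `|q - p| + `|v|) * Mb n)).
  move=> n; have [_ hb] := pw n _ qq; have [da db] := dp n _ _ z qq qq.
  apply: le_trans (ler_normD _ _) _; apply: lerD; first by rewrite mulrC.
  rewrite mulrDl [leRHS]mulrDl; apply: le_trans (ler_normD _ _) _; apply: lerD.
    rewrite !quat_normM mulrAC [leRHS]mulrAC ler_wpM2r//.
    by rewrite mulrC in db; rewrite mulrC (mulrC `|z|).
  by rewrite !quat_normM mulrAC mulrC ler_wpM2l.
by apply: zsummableD; exact: zsummableZ.
Qed.

Let shift_cvg q v : h *: v + q @[h --> (0 : R)^'] --> q.
Proof.
rewrite -[X in _ --> X]add0r -[X in _ --> X + _](scale0r v).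
have h_cvg : (h : R) @[h --> (0 : R)^'] --> (0 : R) by exact: nbhs_dnbhs.
by apply: cvgD; [apply: cvgZ|]; try exact: cvg_cst.
Qed.

Let shell_near q v (r1 r2 : R) : r1 < `|Qp p q| < r2 ->
  \forall h \near (0 : R)^', r1 < `|Qp p (h *: v + q)| < r2.
Proof.
move=> /andP[r1q qr2].
have Q_cvg : `|Qp p (h *: v + q)| @[h --> (0 : R)^'] --> `|Qp p q|.
  by apply: norm_Qp_cvg; exact: shift_cvg.
have Q_gt := cvgr_gt _ Q_cvg _ r1q; have Q_lt := cvgr_lt _ Q_cvg _ qr2.
by near=> h; apply/andP; split; near: h; [exact: Q_gt|exact: Q_lt].
Unshelve. all: by end_near. Qed.

(** For small nonzero [h] the difference quotient of the sum is the series of the termwise quotients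
    [D h n], and Tannery's theorem lets [h] tend to 0 inside it. *)
Lemma laurent_derive q v : S q ->
  h^-1 *: (zseries (laurent_term^~ (h *: v + q)) - zseries (laurent_term^~ q))
  @[h --> 0^'] --> zseries (laurent_diff q ^~ v).
Proof.
move=> Sq; have /andP[q1 q2] := shell_R Sq.
(* Midpoints, so that [h *: v + q] stays in a smaller shell, with one pair of majorants, for all
   small [h]. *)
pose r1 := (R1 ^+ 2 + `|Qp p q|) / 2; pose r2 := (`|Qp p q| + R2 ^+ 2) / 2.
have h1 : R1 ^+ 2 < r1 by rewrite /r1; lra.
have h2 : r2 < R2 ^+ 2 by rewrite /r2; lra.
have r1q : r1 < `|Qp p q| by rewrite /r1; lra.
have qr2 : `|Qp p q| < r2 by rewrite /r2; lra.
have h12 : r1 <= r2 by lra.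
have [Ma [Mb [sa sb Mb0 [pw dp]]]] := majorants h1 h12 h2.
set w := q - (q0 p)%:A; pose z (h : R) := v * w + w * v + h *: (v * v).
have h_cvg : (h : R) @[h --> (0 : R)^'] --> (0 : R) by exact: nbhs_dnbhs.
have q_cvg := @shift_cvg q v.
have z_cvg : z h @[h --> (0 : R)^'] --> v * w + w * v.
  rewrite -[X in _ --> X]addr0 -[X in _ --> _ + X](scale0r (v * v)).
  by apply: cvgD; [|apply: cvgZ]; try exact: cvg_cst.
have Q_cvg : Qp p (h *: v + q) @[h --> (0 : R)^'] --> Qp p q.
  under eq_fun do rewrite QpE; rewrite QpE.
  apply: cvgD; last exact: cvg_cst.
  by apply: quat_cvgX; apply: cvgB q_cvg _; exact: cvg_cst.
have Q_near : \forall h \near (0 : R)^', r1 < `|Qp p (h *: v + q)| < r2.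
  by apply: shell_near; rewrite r1q.
(* Written with [dpow], the quotient involves no division by [h], so its limit at 0 follows from
   continuity. *)
pose D (h : R) n := dpow n (Qp p (h *: v + q)) (Qp p q) (z h) * a n +
  (dpow n (Qp p (h *: v + q)) (Qp p q) (z h) * (h *: v + q - p)
   + Qp p q ^ n * v) * b n.
have Q0 := shell_Qp_neq0 Sq.
have quotient : \forall h \near (0 : R)^',
    zseries (D h) =
    h^-1 *: (zseries (laurent_term^~ (h *: v + q)) - zseries (laurent_term^~ q)).
  near=> h.
  have h0 : h != 0 by near: h; exact: nbhs_dnbhs_neq.
  have Qr : r1 < `|Qp p (h *: v + q)| < r2 by near: h.
  have Sq' : S (h *: v + q).
    by case/andP: Qr => ? ?; rewrite /S /cassini_shell /=; apply/andP; split; lra.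
  have [t1 t2] := (laurent_term_zsummable Sq', laurent_term_zsummable Sq).
  have tN : zsummable (fun n => `|(-1) * laurent_term n q|).
    by apply: zsummable_le t2 => n; rewrite mulN1r normrN normr_ge0 lexx.
  have tB : zsummable
      (fun n => `|laurent_term n (h *: v + q) + (-1) * laurent_term n q|).
    by apply: dominated_zsummable (zsummableD t1 tN) => n; exact: ler_normD.
  rewrite -[h^-1 *: _]mulr_algl -[X in _ - X]mul1r -mulNr -(zseriesMl _ t2).
  rewrite -(zseriesD t1 tN) -(zseriesMl _ tB); congr zseries; apply/funext => n.
  have Q'0 := shell_Qp_neq0 Sq'.
  have dQ : dpow n (Qp p (h *: v + q)) (Qp p q) (z h)
      = h^-1 *: (Qp p (h *: v + q) ^ n - Qp p q ^ n).
    by rewrite -dpow_sub// Qp_shift dpowZ scalerA mulVf// scale1r.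
  have dv : Qp p q ^ n * v = h^-1 *: (Qp p q ^ n * (h *: v)).
    by rewrite -scalerAr scalerA mulVf// scale1r.
  rewrite /D dQ dv mulN1r mulr_algl /laurent_term -addrA.
  rewrite -!scalerAl -scalerDr -scalerAl -scalerDr; congr (_ *: _).
  move: (h *: v) (q - p) (_ ^ n) (_ ^ n) => k u Y X.
  (* The discrete product rule, with [X] and [Y] the powers at the shifted point and at [q], and [k]
     the increment of [u = q - p]. *)
  have -> : (X - Y) * (k + u) + Y * k = X * (k + u) - Y * u.
    by rewrite mulrBl -addrA (mulrDr Y) opprD addrAC addNr add0r.
  by rewrite !mulrBl opprD [RHS]addrACA.
apply: cvg_trans (near_eq_cvg quotient) _.
(* Bounds, valid for [|h| <= 1], of [z h] and of [h *: v + q - p]. *)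
pose B := `|v * w + w * v| + `|v * v|; pose C := `|v| + `|q - p|.
apply: (@dominated_cvg_zseries R _ _ _ D _
  (fun n => B * Ma n + (B * C + `|v|) * Mb n)).
- move=> n; apply: cvgD.
    by apply: quat_cvgM; [exact: dpow_cvg|exact: cvg_cst].
  apply: quat_cvgM; last exact: cvg_cst.
  apply: cvgD; last exact: cvg_cst.
  apply: quat_cvgM; first exact: dpow_cvg.
  by apply: cvgB q_cvg _; exact: cvg_cst.
- near=> h => n.
  have Qr : r1 < `|Qp p (h *: v + q)| < r2 by near: h.
  have hle : `|h| <= 1 by near: h; exact: cvgr0_norm_le h_cvg _ ltr01.
  have zB : `|z h| <= B.
    apply: le_trans (ler_normD _ _) _; rewrite lerD2l normrZ.
    by rewrite -[leRHS]mul1r ler_wpM2r.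
  have qC : `|h *: v + q - p| <= C.
    rewrite -addrA; apply: le_trans (ler_normD _ _) _; rewrite lerD2r normrZ.
    by rewrite -[leRHS]mul1r ler_wpM2r.
  have Qr' : r1 <= `|Qp p (h *: v + q)| <= r2 by case/andP: Qr => *; rewrite !ltW.
  have qr : r1 <= `|Qp p q| <= r2 by rewrite !ltW.
  have [_ hb] := pw n _ qr; have [da db] := dp n _ _ (z h) Qr' qr.
  have Ma0 : 0 <= Ma n by have [+ _] := pw n _ qr; apply: le_trans.
  apply: le_trans (ler_normD _ _) _; apply: lerD.
    by apply: le_trans da _; rewrite mulrC ler_wpM2r.
  rewrite mulrDl [leRHS]mulrDl; apply: le_trans (ler_normD _ _) _; apply: lerD.
    rewrite !quat_normM mulrAC [leRHS]mulrAC; apply: ler_pM => //.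
    by apply: le_trans db _; rewrite mulrC ler_wpM2r.
  by rewrite !quat_normM mulrAC mulrC ler_wpM2l.
- by apply: zsummableD; exact: zsummableZ.
Unshelve. all: by end_near. Qed.

(** Taking [s] to be the identity or the conjugation covers both formulas; the same device is used
    for the power series below. *)
Lemma laurent_kernel_cvg (s : quat R -> quat R) : (forall q, `|s q| = `|q|) ->
  cvg_abs_unif_compacts S (fun n q =>
    calL n q p * (q0 q - q0 p)%:A * (a n + (s q - p) * b n)).
Proof.
move=> s_norm; apply: dominated_cvg_abs_unif => K cK KS.
have [r1 [r2 [B [h1 h12 h2 B0 KB]]]] := cassini_compact R10 R12 cK KS.
have [Ma [Mb [sa sb Mb0 [_ dp]]]] := majorants h1 h12 h2.
exists (fun n => (B + `|p|) * (Ma n + (B + `|p|) * Mb n)).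
  exact/zsummableZ/zsummableD/zsummableZ.
move=> n q Kq; have [Qr qB] := KB _ Kq; rewrite calLE.
set L := dpow _ _ _ _.
have [] := dp n (quat_conj (Qp p q)) (Qp p q) 1 _ Qr.
  by rewrite quat_norm_conj.
rewrite -/L quat_norm1 !mulr1 => La Lb.
have kB : `|q0 q - q0 p| <= B + `|p|.
  apply: le_trans (ler_normB _ _) _; apply: lerD; last exact: norm_q0_le.
  exact: le_trans (norm_q0_le q) qB.
have sB : `|s q - p| <= B + `|p|.
  by apply: le_trans (ler_normB _ _) _; rewrite s_norm lerD2r.
rewrite mulr_algr -scalerAl normrZ; apply: ler_pM => //.
rewrite mulrDr; apply: le_trans (ler_normD _ _) _; apply: lerD => //.
rewrite !quat_normM mulrCA; exact: ler_pM.
Qed.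

Lemma laurent_power_cvg (s : quat R -> quat R) :
  (forall q, `|Qp p (s q)| = `|Qp p q|) ->
  cvg_abs_unif_compacts S (fun n q => Qp p (s q) ^ n * b n).
Proof.
move=> s_norm; apply: dominated_cvg_abs_unif => K cK KS.
have [r1 [r2 [B [h1 h12 h2 B0 KB]]]] := cassini_compact R10 R12 cK KS.
have [Ma [Mb [sa sb Mb0 [pw _]]]] := majorants h1 h12 h2.
exists Mb => // n q Kq; rewrite quat_normM.
by have [] := pw n (Qp p (s q)) _; rewrite ?s_norm//; have [] := KB _ Kq.
Qed.

Lemma fueter_sum_laurent_diff q n :
  fueter_sum (laurent_diff q n)
  = - 4 * (calL n q p * (q0 q - q0 p)%:A * (a n + (q - p) * b n))
    + - 2 * (Qp p (quat_conj q) ^ n * b n).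
Proof.
rewrite /laurent_diff fueter_sumD !fueter_sumMr fueter_sumD fueter_sumMr.
rewrite fueter_sum_Qp fueter_sumMl quat_conjXz -Qp_conj.
by rewrite mulrDl addrA -!mulrA -!mulrDr.
Qed.

(** Replacing [q] by its conjugate in the bracket adds [- 4] times the kernel term with factor
    [quat_conj q - q]. By [calL_conj_sub] this is [- 2] times the difference of the two powers,
    which the other summand compensates. *)
Lemma kernel_conj_swap q n : S q ->
  - 4 * (calL n q p * (q0 q - q0 p)%:A * (a n + (q - p) * b n))
    + - 2 * (Qp p (quat_conj q) ^ n * b n)
  = - 4 * (calL n q p * (q0 q - q0 p)%:A * (a n + (quat_conj q - p) * b n))
    + - 2 * (Qp p q ^ n * b n).
Proof.
move=> Sq; have := calL_conj_sub n (shell_Qp_neq0 Sq).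
rewrite Qp_conj -quat_conjXz.
rewrite (_ : (2 * (q0 q - q0 p))%:A = (q0 q - q0 p)%:A *+ 2 :> quat R); last by rewrite mulr2n; congr Quat => /=; ring.
set P := _ * (q0 q - q0 p)%:A; set X := quat_conj q - q.
rewrite mulrnAr -/P => /(canRL (subrK _)) ->.
rewrite (_ : quat_conj q - p = X + (q - p)); last by rewrite subrKA.
have -> : a n + (X + (q - p)) * b n = a n + (q - p) * b n + X * b n.
  by rewrite mulrDl addrCA addrC.
rewrite [in RHS]mulrDr [in RHS]mulrDr -addrA; congr (_ + _).
rewrite mulrDl mulrDr; congr (_ + _).
by rewrite !mulrnAl mulrnAr -mulrnAl mulNrn -mulrnA !mulrA.
Qed.

(** A directional derivative at [q] sees [f] only near [q], where it equals its expansion; absolute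
    convergence then merges the four differentiated series into one. *)
Lemma cauchy_fueter_laurent q f : S q ->
  (forall q', S q' -> f q' = zseries (laurent_term^~ q')) ->
  cauchy_fueter f q = zseries (fun n => fueter_sum (laurent_diff q n)).
Proof.
move=> Sq fE.
have D v : 'D_v f q = zseries (laurent_diff q ^~ v).
  rewrite /derive; apply/cvg_lim => //.
  apply: cvg_trans; last exact: laurent_derive Sq.
  apply: near_eq_cvg.
  near=> h; rewrite /= !fE//.
  by near: h; exact: shell_near.
have sm c v : zsummable (fun n => `|c * laurent_diff q n v|).
  apply: zsummable_le (zsummableZ `|c| (laurent_diff_zsummable v Sq)) => n.
  by rewrite quat_normM lexx mulr_ge0.
rewrite /cauchy_fueter !D /fueter_sum.
have s1 := laurent_diff_zsummable 1 Sq.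
have s2 := dominated_zsummable (fun n => ler_normD _ _)
  (zsummableD s1 (sm (qe1 R) (qe1 R))).
have s3 := dominated_zsummable (fun n => ler_normD _ _)
  (zsummableD s2 (sm (qe2 R) (qe2 R))).
rewrite (zseriesD s3) ?(zseriesD s2) ?(zseriesD s1); try exact: sm.
by rewrite !(zseriesMl _ (laurent_diff_zsummable _ Sq)).
Unshelve. all: by end_near. Qed.

End LaurentDerivative.

Theorem theorem6p12 (R : realType) (p : quat R) (R1 R2 : R)
    (hR1 : 0 < R1) (hR12 : R1 < R2)
    (Omega : set (quat R)) (f : quat R -> quat R) (a : int -> quat R)
    (Omega_open : open Omega) (Omega_axial : axially_symmetric Omega)
    (shell_sub : cassini_shell p R1 R2 `<=` Omega)
    (f_slice : left_slice_hyperholomorphic Omega f)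
    (f_cvg_even : cvg_abs_unif_compacts (cassini_shell p R1 R2)
       (fun n q => Qp p q ^ n * a (2 * n)))
    (f_cvg_odd : cvg_abs_unif_compacts (cassini_shell p R1 R2)
       (fun n q => Qp p q ^ n * (q - p) * a (2 * n + 1)))
    (f_laurent : forall q, cassini_shell p R1 R2 q ->
       f q = zseries (fun n => Qp p q ^ n * a (2 * n))
           + zseries (fun n => Qp p q ^ n * (q - p) * a (2 * n + 1))) :
  let g := cauchy_fueter f in
  let S := cassini_shell p R1 R2 in
  [/\ forall q, S q ->
        g q = - 4 * zseries (fun n => calL n q p * (q0 q - q0 p)%:A
                      * (a (2 * n) + (quat_conj q - p) * a (2 * n + 1)))
              - 2 * zseries (fun n => Qp p q ^ n * a (2 * n + 1)),
      forall q, S q ->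
        g q = - 4 * zseries (fun n => calL n q p * (q0 q - q0 p)%:A
                      * (a (2 * n) + (q - p) * a (2 * n + 1)))
              - 2 * zseries (fun n => Qp p (quat_conj q) ^ n * a (2 * n + 1)),
      cvg_abs_unif_compacts S (fun n q => calL n q p * (q0 q - q0 p)%:A
                      * (a (2 * n) + (quat_conj q - p) * a (2 * n + 1)))
        /\ cvg_abs_unif_compacts S (fun n q => Qp p q ^ n * a (2 * n + 1)) &
      cvg_abs_unif_compacts S (fun n q => calL n q p * (q0 q - q0 p)%:A
                      * (a (2 * n) + (q - p) * a (2 * n + 1)))
        /\ cvg_abs_unif_compacts S
             (fun n q => Qp p (quat_conj q) ^ n * a (2 * n + 1))].
Proof.
have zs F : cvg_abs_unif_compacts (cassini_shell p R1 R2) F ->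
    forall q, cassini_shell p R1 R2 q -> zsummable (fun n => `|F n q|).
  by case=> cF _ _ q Sq; apply/summable_zsummable => //; exact: cF.
pose ae n := a (2 * n); pose ao n := a (2 * n + 1).
(* The even terms carry the factor [c q = 1], the odd ones [c q = q - p], which vanishes only at
   [p]. *)
have ae_summable : forall s, R1 ^+ 2 < s < R2 ^+ 2 ->
    zsummable (fun n => s ^ n * `|ae n|).
  apply: (@laurent_coef_zsummable _ p _ _ (fun=> 1)) => [q _|q Sq].
    exact: oner_neq0.
  by under eq_fun do rewrite mulr1; exact: zs f_cvg_even q Sq.
have ao_summable : forall s, R1 ^+ 2 < s < R2 ^+ 2 ->
    zsummable (fun n => s ^ n * `|ao n|).
  apply: (@laurent_coef_zsummable _ p _ _ (fun q => q - p)) => [q|q Sq].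
    by rewrite subr_eq0.
  exact: zs f_cvg_odd q Sq.
have kernel1 := laurent_kernel_cvg p ae_summable ao_summable hR1 hR12
  (@quat_norm_conj R).
have kernel2 := laurent_kernel_cvg p ae_summable ao_summable hR1 hR12
  (fun q => erefl `|q|).
have power1 := laurent_power_cvg ae_summable ao_summable hR1 hR12 (s := id)
  (fun q => erefl `|Qp p q|).
have power2 := laurent_power_cvg ae_summable ao_summable hR1 hR12
  (s := @quat_conj R) (fun q => etrans (congr1 _ (Qp_conj p q)) (quat_norm_conj _)).
have fT q : cassini_shell p R1 R2 q -> f q = zseries (laurent_term p ae ao ^~ q).
  move=> Sq; rewrite f_laurent// -zseriesD//.
    exact: zs f_cvg_even q Sq.
  exact: zs f_cvg_odd q Sq.
move=> g S.
(* Differentiation yields the second formula directly; the first one follows from it term by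
   term. *)
have gE2 q : S q -> g q = - 4 * zseries (fun n => calL n q p * (q0 q - q0 p)%:A
    * (ae n + (q - p) * ao n)) - 2 * zseries (fun n => Qp p (quat_conj q) ^ n * ao n).
  move=> Sq; rewrite /g (cauchy_fueter_laurent ae_summable ao_summable Sq fT).
  rewrite -[X in _ = _ + X]mulNr -zseries_lin; [|exact: zs kernel2 q Sq|exact: zs power2 q Sq].
  by apply: congr1; apply/funext => n; exact: fueter_sum_laurent_diff.
have gE1 q : S q -> g q = - 4 * zseries (fun n => calL n q p * (q0 q - q0 p)%:A
    * (ae n + (quat_conj q - p) * ao n)) - 2 * zseries (fun n => Qp p q ^ n * ao n).
  move=> Sq; rewrite (gE2 q Sq) -[X in _ + X = _]mulNr -[X in _ = _ + X]mulNr.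
  rewrite -(zseries_lin _ _ (zs _ kernel2 q Sq) (zs _ power2 q Sq)).
  rewrite -(zseries_lin _ _ (zs _ kernel1 q Sq) (zs _ power1 q Sq)).
  by apply: congr1; apply/funext => n; exact: kernel_conj_swap Sq.
split; [exact: gE1|exact: gE2|exact: conj kernel1 power1|exact: conj kernel2 power2].
Qed.
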